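(* Let $(X,\preccurlyeq)$ be a chain-complete poset and let $\mathcal{F}$ be a non-empty commutative family of isotone mappings from $X$ into itself. Suppose that every element of $\mathcal{F}$ is chain-continuous. Then $$ \mathbf{Fix}(\mathcal{F})=\bigl\{\sup\{\varphi(x)\mid\varphi\in\mathrm{Iter}(\mathcal{F})\}\ \bigm|\ x\in\mathrm{Ext}(\mathcal{F})\bigr\} $$ (where the suprema, taken in $X$, exist for every $x\in\mathrm{Ext}(\mathcal{F})$), and, in particular, the least element $\bot_{\mathbf{Fix}(\mathcal{F})}$ of $\mathbf{Fix}(\mathcal{F})$ with respect to the induced order exists and is given by $$ \bot_{\mathbf{Fix}(\mathcal{F})}=\sup\{\varphi(\bot)\mid\varphi\in\mathrm{Iter}(\mathcal{F})\}, $$ where $\bot$ is the least element of $X$.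
   Context: Let $(X,\preccurlyeq)$ be a partially ordered set (poset). A subset $C\subset X$ is a chain if it is totally ordered by $\preccurlyeq$; the empty set is a chain. The poset is chain-complete if every chain $C\subset X$ (including the empty one) has a least upper bound $\sup C$ in $X$; in particular $X$ has a least element $\bot=\sup\varnothing$ and is non-empty. A mapping $f:X\to X$ is isotone if $x\preccurlyeq y$ implies $f(x)\preccurlyeq f(y)$ for all $x,y\in X$. It is chain-continuous if for every non-empty chain $C\subset X$ one has $f(\sup C)=\sup\{f(w): w\in C\}$. For a non-empty family $\mathcal{F}$ of mappings $X\to X$: - $\mathcal{F}$ is commutative if $fg=gf$ for all $f,g\in\mathcal{F}$, where $fg$ denotes the composition $x\mapsto f(g(x))$. - $\mathrm{Ext}(\mathcal{F})=\{x\in X\mid x\preccurlyeq f(x)\ \text{for all } f\in\mathcal{F}\}$ (the extensivity domain). - $\mathrm{Iter}(\mathcal{F})=\{fg\cdots h\mid f,g,\ldots,h\in\mathcal{F}\}$ is the set of all finite compositions of (one or more, possibly repeated) mappings from $\mathcal{F}$. - $\mathbf{Fix}(f)=\{x\in X\mid x=f(x)\}$ and $\mathbf{Fix}(\mathcal{F})=\bigcap_{f\in\mathcal{F}}\mathbf{Fix}(f)$ is the set of joint fixed points of $\mathcal{F}$. *)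

(* Defs.v *)
From mathcomp Require Import all_boot all_order.
From mathcomp Require Import boolp classical_sets.

Set Implicit Arguments.
Unset Strict Implicit.
Unset Printing Implicit Defensive.

Local Open Scope classical_set_scope.
Local Open Scope order_scope.

Section Defs.
Context {d : Order.disp_t} {X : porderType d}.
Implicit Types (C A : set X) (f g : X -> X) (F : set (X -> X)).

Definition chain C : Prop := total_on C (fun x y => x <= y).

(* [set0] is a chain, so this yields a least element of [X]. *)
Definition chain_complete : Prop :=
  forall C, chain C -> exists m, isLub C m.

Definition isotone f : Prop := {homo f : x y / x <= y}.

(* Suprema are handled relationally: [isLub C m] reads "sup C exists and is
   equal to m". *)
Definition chain_continuous f : Prop :=
  forall C, chain C -> C !=set0 -> forall m, isLub C m -> isLub (f @` C) (f m).

Definition commutative_family F : Prop :=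
  forall f g, F f -> F g -> f \o g = g \o f.

Definition Ext F : set X := [set x | forall f, F f -> x <= f x].

(* Compositions of one or more members of [F]; the identity belongs to
   [Iter F] only when it is such a composition. *)
Inductive Iter F : set (X -> X) :=
| Iter_base f : F f -> Iter F f
| Iter_comp f phi : F f -> Iter F phi -> Iter F (f \o phi).

Definition Fix1 f : set X := [set x | x = f x].

Definition Fix F : set X := \bigcap_(f in F) Fix1 f.

Definition isLeast A (m : X) : Prop := A m /\ lbound A m.

End Defs.

Arguments chain_complete {d} X.

(* Main.v *)
Require Import Defs.
From mathcomp Require Import all_boot all_order.
From mathcomp Require Import boolp classical_sets.

Import Order.POrderTheory.

Local Open Scope classical_set_scope.
Local Open Scope order_scope.

(** Fix [x] in [Ext F], and consider the points [y] of [Ext F] above [x] such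
    that [phi y] lies below every upper bound of the orbit
    [{phi x | phi in Iter F}], for all [phi] in [Iter F]. They form a set
    containing [x] that is stable under [F] (by commutativity) and under suprema
    of non-empty chains (by continuity). A maximal such point, given by Zorn's
    lemma, is a joint fixed point, hence the supremum of the orbit. Thus only
    suprema of chains are used, although the orbit is merely directed. *)

Lemma isLub_unique {d : Order.disp_t} {X : porderType d} {A : set X} {m n : X} :
  isLub A m -> isLub A n -> m = n.
Proof.
by move=> [mu mle] [nu nle]; apply/le_anti; rewrite mle // nle.
Qed.

Lemma chain_image {d : Order.disp_t} {X : porderType d} {f : X -> X}
    {C : set X} : isotone f -> chain C -> chain (f @` C).
Proof.
move=> fiso Cch _ _ [s Cs <-] [t Ct <-].
by case: (Cch s t Cs Ct) => st; [left|right]; apply: fiso.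
Qed.

(** Zorn's lemma on the subtype of points of [A]: a non-empty chain is bounded by its supremum in
    [X], which stays in [A]. *)
Lemma zorn_chain_closed {d : Order.disp_t} {X : porderType d} {A : set X} :
    chain_complete X -> A !=set0 ->
    (forall C m, C `<=` A -> chain C -> C !=set0 -> isLub C m -> A m) ->
  exists2 m, A m & forall y, A y -> m <= y -> y = m.
Proof.
move=> Xcc [x Ax] Asup.
pose R : rel {y | A y} := fun s t => sval s <= sval t.
have sval_eq (s t : {y | A y}) : sval s = sval t -> s = t.
  by case: s t => [s As] [t At] /= st; apply: eq_exist.
have [||s t st ts|B Bch|[m Am] mmax] := @Zorn _ R.
- by move=> t; exact: lexx.
- by move=> r s t; exact: le_trans.
- by apply/sval_eq/le_anti/andP.
(* The supremum of the empty chain may lie outside [A], so the given point [x] serves as its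
   bound. *)
- have [[b Bb]|B0] := pselect (B !=set0); last first.
    by exists (exist _ x Ax) => s Bs; case: B0; exists s.
  pose C := sval @` B.
  have Cch : chain C.
    by move=> _ _ [s Bs <-] [t Bt <-]; exact: Bch.
  have [m mlub] := Xcc C Cch.
  have Am : A m.
    apply: (Asup C) mlub => //; last by exists (sval b), b.
    by move=> _ [s _ <-]; exact: svalP.
  exists (exist _ m Am) => s Bs.
  by apply: mlub.1; exists s.
- exists m => // y Ay my.
  by have [] := mmax (exist _ y Ay) my.
Qed.

Section Iterates.
Context {d : Order.disp_t} {X : porderType d} {F : set (X -> X)}.

Lemma Iter_isotone (phi : X -> X) :
  (forall f, F f -> isotone f) -> Iter F phi -> isotone phi.
Proof.
move=> Fiso; elim=> [f /Fiso //|f psi Ff _ IH x y xy].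
exact: Fiso (IH _ _ xy).
Qed.

Lemma Iter_chain_continuous (phi : X -> X) :
    (forall f, F f -> isotone f) -> (forall f, F f -> chain_continuous f) ->
  Iter F phi -> chain_continuous phi.
Proof.
move=> Fiso Fcont; elim=> [f /Fcont //|f psi Ff psiF IH C Cch C0 m mlub].
rewrite -image_comp; apply: (Fcont f Ff).
- exact: chain_image (Iter_isotone _ Fiso psiF) Cch.
- exact: image_nonempty.
- exact: IH.
Qed.

Lemma Iter_commute (f phi : X -> X) :
  commutative_family F -> F f -> Iter F phi -> phi \o f = f \o phi.
Proof.
move=> Fcomm Ff; elim=> [g Fg|g psi Fg _ IH]; first exact: Fcomm.
by rewrite -compA IH compA (Fcomm g f Fg Ff).
Qed.

Lemma Iter_fix (phi : X -> X) (p : X) : Fix F p -> Iter F phi -> phi p = p.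
Proof.
move=> pfix; elim=> [f /pfix <- //|f psi Ff _ /= ->].
by rewrite -(pfix f Ff).
Qed.

Lemma Ext_isLub (C : set X) (m : X) :
  (forall f, F f -> isotone f) -> C `<=` Ext F -> isLub C m -> Ext F m.
Proof.
move=> Fiso CE [mub mle] f Ff; apply: mle => c Cc.
by apply: le_trans (CE c Cc f Ff) _; apply: (Fiso f Ff); exact: mub.
Qed.

Lemma Ext_orbit_isLub_Fix (x : X) :
    chain_complete X -> F !=set0 -> commutative_family F ->
    (forall f, F f -> isotone f) -> (forall f, F f -> chain_continuous f) ->
  Ext F x -> exists2 m, Fix F m & isLub [set phi x | phi in Iter F] m.
Proof.
move=> Xcc [f0 Ff0] Fcomm Fiso Fcont xE.
set D := [set phi x | phi in Iter F].
(* The last condition refers to all upper bounds of [D], since [sup D] is not yet known to exist. *)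
pose A := [set y | [/\ x <= y, Ext F y &
                      forall phi, Iter F phi -> lbound (ubound D) (phi y)]].
have [||m [xm mE mD] mmax] := @zorn_chain_closed d X A Xcc.
- exists x; split=> // phi phiF u; apply.
  by exists phi.
- move=> C m CA Cch [c Cc] mlub; split.
  + by have [xc _ _] := CA c Cc; apply: le_trans xc (mlub.1 c Cc).
  + by apply: Ext_isLub mlub => // y /CA [].
  + move=> phi phiF u uD.
    have C0 : C !=set0 by exists c.
    have [_] := Iter_chain_continuous phi Fiso Fcont phiF C Cch C0 m mlub.
    apply=> _ [y Cy <-].
    by have [_ _] := CA y Cy; apply.
have mfix : Fix F m.
  (* As [m <= f m], maximality gives [f m = m] once [f m] is in [A]. *)
  move=> f Ff; apply/esym/mmax; last exact: mE.
  split; first exact: le_trans xm (mE f Ff).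
  - move=> g Fg; have /(congr1 (@^~ m))/= -> := Fcomm g f Fg Ff.
    by apply: (Fiso f Ff); exact: mE.
  - move=> phi phiF.
    have /(congr1 (@^~ m))/= -> := Iter_commute f phi Fcomm Ff phiF.
    exact: (mD (f \o phi) (Iter_comp Ff phiF)).
exists m => //; split=> [_ [phi phiF <-]|u uD].
- rewrite -[leRHS](Iter_fix phi m mfix phiF).
  exact: (Iter_isotone phi Fiso phiF).
(* Writing [m] as [f0 m] with [f0] in [Iter F] brings it under the last condition of [A]. *)
- rewrite (mfix f0 Ff0).
  exact: mD (Iter_base Ff0) u uD.
Qed.

End Iterates.

Theorem theorem1 (d : Order.disp_t) (X : porderType d) (F : set (X -> X))
    (hX : chain_complete X)
    (hF0 : F !=set0)
    (hFcomm : commutative_family F)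
    (hFiso : forall f, F f -> isotone f)
    (hFcont : forall f, F f -> chain_continuous f) :
  [/\ forall x, Ext F x ->
        exists m, isLub [set phi x | phi in Iter F] m,
      Fix F = [set m | exists2 x, Ext F x &
                         isLub [set phi x | phi in Iter F] m]
    & exists2 bot : X, isLeast [set: X] bot &
        exists2 botFix : X, isLeast (Fix F) botFix &
          isLub [set phi bot | phi in Iter F] botFix].
Proof.
have orbit_sup x := @Ext_orbit_isLub_Fix d X F x hX hF0 hFcomm hFiso hFcont.
split.
- by move=> x /orbit_sup [m _ mlub]; exists m.
- apply/seteqP; split=> [p pfix|m [x /orbit_sup [n nfix nlub] mlub]].
    (* The orbit of a joint fixed point [p] is the singleton of [p], non-empty because [F] is. *)
    exists p; first by move=> f Ff; rewrite -(pfix f Ff).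
    split=> [_ [phi phiF <-]|u uD]; first by rewrite (Iter_fix phi p pfix phiF).
    have [f Ff] := hF0; rewrite (pfix f Ff); apply: uD.
    by exists f => //; exact: Iter_base.
  by rewrite (isLub_unique mlub nlub).
- have [|bot [_ botle]] := hX set0; first by move=> s t [].
  have botP y : bot <= y by apply: botle.
  exists bot; first by split=> // y _; exact: botP.
  have [|m mfix mlub] := orbit_sup bot; first by move=> f _; exact: botP.
  (* Every joint fixed point [p] bounds the orbit of [bot]: [phi bot <= phi p = p]. *)
  exists m => //; split=> // p pfix; apply: mlub.2 => _ [phi phiF <-].
  rewrite -(Iter_fix phi p pfix phiF).
  exact: (Iter_isotone phi hFiso phiF).
Qed.
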